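(* Let $\mathbf{C}$ be a 0-cell in a (strict) 2-category $\mathcal K$. There is a one-to-one correspondence between: (1) tuples $(S,T,U,r,s)$ where $S,T,U$ are monads on $\mathbf C$ and $r\colon ST\Rightarrow U$, $s\colon U\Rightarrow ST$ form a distributing retraction of $ST$ onto $U$; (2) tuples $(S,T,U,\lambda,r,s)$ where $S$ and $T$ are monads on $\mathbf C$, $U$ is a 1-cell on $\mathbf C$, $\lambda\colon TS\Rightarrow ST$ is a weak distributive law of $S$ over $T$, and $r\colon ST\Rightarrow U$, $s\colon U\Rightarrow ST$ form a splitting of the idempotent $e := S\mu^T\circ\lambda T\circ\eta^T ST$ (i.e. $r\circ s = U$ and $s\circ r = e$). From (1) to (2), $\lambda := s\circ\mu^U\circ ji$, where $i := r\circ S\eta^T$ and $j := r\circ\eta^S T$. From (2) to (1), $\eta^U := r\circ\eta^S\eta^T$ and $\mu^U := r\circ\mu^S\mu^T\circ S\lambda T\circ ss$. In both directions the remaining components are unchanged.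
   Context: Horizontal composition of 1-cells and 2-cells is written by juxtaposition, vertical composition by $\circ$; a 1-cell $F$ also denotes its identity 2-cell; $\mathrm{1}_{\mathbf C}$ is the identity 1-cell. A monad $(T,\eta^T,\mu^T)$ on $\mathbf C$ is a 1-cell $T\colon\mathbf C\to\mathbf C$ with 2-cells $\eta^T\colon 1_{\mathbf C}\Rightarrow T$, $\mu^T\colon TT\Rightarrow T$ such that $\mu^T\circ T\eta^T=T=\mu^T\circ\eta^T T$ and $\mu^T\circ T\mu^T=\mu^T\circ\mu^T T$. For a monad $S$ and a 2-cell $f\colon F\Rightarrow SG$, its extension is $f^{\underline S}:=\mu^S G\circ Sf\colon SF\Rightarrow SG$. A distributing retraction of $ST$ onto $U$ (for monads $S,T,U$ on $\mathbf C$) is a pair of 2-cells $r\colon ST\Rightarrow U$, $s\colon U\Rightarrow ST$ with $r\circ s=U$ such that, with $i:=r\circ S\eta^T\colon S\Rightarrow U$, $j:=r\circ\eta^S T\colon T\Rightarrow U$, $e:=s\circ r\colon ST\Rightarrow ST$: - $r\circ\eta^S\eta^T=\eta^U$; - $r\circ\mu^S T=\mu^U\circ ir$; - $r\circ S\mu^T=\mu^U\circ rj$; - $e\circ\eta^S T=\eta^S T$; - $e\circ S\mu^T=S\mu^T\circ eT$; - $e\circ(s\circ\mu^U\circ jU)^{\underline S}=(s\circ\mu^U\circ jU)^{\underline S}\circ eU$. A weak distributive law of $S$ over $T$ is a 2-cell $\lambda\colon TS\Rightarrow ST$ such that $\lambda\circ T\eta^S=\eta^S T$, $\lambda\circ T\mu^S=\mu^S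 T\circ S\lambda\circ\lambda S$, and $\lambda\circ\mu^T S=S\mu^T\circ\lambda T\circ T\lambda$. *)

(* Defs.v *)
Set Implicit Arguments.
Unset Strict Implicit.
Unset Printing Implicit Defensive.

(* In a strict 2-category the 1-cells H (G F) and (H G) F are equal but not
   convertible, so 2-cells are compared after transport along equalities of
   their source and target 1-cells. *)
Definition cast (X : Type) (hom : X -> X -> Type) (F F' G G' : X)
    (p : F = F') (q : G = G') (a : hom F G) : hom F' G' :=
  match p in _ = F1, q in _ = G1 return hom F1 G1 with
  | eq_refl, eq_refl => a
  end.

(* [comp1 G F] is the composite G F, i.e. F first; likewise [vcomp b a] is
   b after a, and [hcomp b a] : G F => G' F' is the horizontal composite b a. *)
Record twocat := TwoCat {
  cell0 :> Type;
  cell1 : cell0 -> cell0 -> Type;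
  cell2 : forall A B, cell1 A B -> cell1 A B -> Type;
  one1 : forall A, cell1 A A;
  comp1 : forall A B C, cell1 B C -> cell1 A B -> cell1 A C;
  one2 : forall A B (F : cell1 A B), cell2 F F;
  vcomp : forall A B (F G H : cell1 A B), cell2 G H -> cell2 F G -> cell2 F H;
  hcomp : forall A B C (G G' : cell1 B C) (F F' : cell1 A B),
    cell2 G G' -> cell2 F F' -> cell2 (comp1 G F) (comp1 G' F');
  comp1A : forall A B C D (H : cell1 C D) (G : cell1 B C) (F : cell1 A B),
    comp1 H (comp1 G F) = comp1 (comp1 H G) F;
  comp1_1l : forall A B (F : cell1 A B), comp1 (one1 B) F = F;
  comp1_1r : forall A B (F : cell1 A B), comp1 F (one1 A) = F;
  vcompA : forall A B (F G H K : cell1 A B)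
      (c : cell2 H K) (b : cell2 G H) (a : cell2 F G),
    vcomp c (vcomp b a) = vcomp (vcomp c b) a;
  vcomp_1l : forall A B (F G : cell1 A B) (a : cell2 F G), vcomp (one2 G) a = a;
  vcomp_1r : forall A B (F G : cell1 A B) (a : cell2 F G), vcomp a (one2 F) = a;
  hcomp_one2 : forall A B C (G : cell1 B C) (F : cell1 A B),
    hcomp (one2 G) (one2 F) = one2 (comp1 G F);
  hcomp_vcomp : forall A B C (G G' G'' : cell1 B C) (F F' F'' : cell1 A B)
      (b' : cell2 G' G'') (b : cell2 G G') (a' : cell2 F' F'') (a : cell2 F F'),
    hcomp (vcomp b' b) (vcomp a' a) = vcomp (hcomp b' a') (hcomp b a);
  hcompA : forall A B C D (H H' : cell1 C D) (G G' : cell1 B C)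
      (F F' : cell1 A B) (c : cell2 H H') (b : cell2 G G') (a : cell2 F F'),
    cast (comp1A H G F) (comp1A H' G' F') (hcomp c (hcomp b a))
    = hcomp (hcomp c b) a;
  hcomp_1l : forall A B (F F' : cell1 A B) (a : cell2 F F'),
    cast (comp1_1l F) (comp1_1l F') (hcomp (one2 (one1 B)) a) = a;
  hcomp_1r : forall A B (F F' : cell1 A B) (a : cell2 F F'),
    cast (comp1_1r F) (comp1_1r F') (hcomp a (one2 (one1 A))) = a
}.

Arguments cell1 {t} A B.
Arguments cell2 {t A B} F G.
Arguments one1 {t} A.
Arguments comp1 {t A B C} G F : rename.
Arguments one2 {t A B} F.
Arguments vcomp {t A B F G H} b a : rename.
Arguments hcomp {t A B C G G' F F'} b a : rename.
Arguments comp1A {t A B C D} H G F.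
Arguments comp1_1l {t A B} F.
Arguments comp1_1r {t A B} F.

(* A 1-cell also denotes its identity 2-cell. *)
Coercion one2 : cell1 >-> cell2.

(* Equalities of 1-cells that follow from associativity and unitality; they are
   found automatically, so that no associator or unitor has to be written. *)
Class strict_eq (K : twocat) (A B : K) (F G : cell1 A B) : Prop :=
  strict_eqP : F = G.

Ltac solve_strict_eq :=
  unfold strict_eq;
  solve [ reflexivity
        | repeat first [rewrite comp1A | rewrite comp1_1l | rewrite comp1_1r];
          reflexivity ].

#[global] Hint Extern 0 (strict_eq _ _) => solve_strict_eq : typeclass_instances.

(* Vertical composition when the two middle 1-cells are only provably equal. *)
Definition svcomp (K : twocat) (A B : K) (F G G' H : cell1 A B)
    (b : cell2 G' H) (a : cell2 F G) {p : strict_eq G G'} : cell2 F H :=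
  vcomp b (cast eq_refl p a).

Definition retype (K : twocat) (A B : K) (F G F' G' : cell1 A B)
    (a : cell2 F G) {p : strict_eq F F'} {q : strict_eq G G'} : cell2 F' G' :=
  cast p q a.

(* Equality of 2-cells whose boundaries are only provably equal.  Equality
   proofs being irrelevant, the choice of p and q does not matter. *)
Definition eq2 (K : twocat) (A B : K) (F G F' G' : cell1 A B)
    (a : cell2 F G) (b : cell2 F' G') : Prop :=
  exists (p : F = F') (q : G = G'), cast p q a = b.

Declare Scope twocat_scope.
Delimit Scope twocat_scope with twocat.
Notation "F ⇒ G" := (cell2 F G) (at level 70, no associativity) : twocat_scope.
Notation "G · F" := (comp1 G F) (at level 35, right associativity) : twocat_scope.
Notation "b ⋆ a" := (hcomp b a) (at level 35, right associativity) : twocat_scope.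
Notation "b ∘ a" := (svcomp b a) (at level 40, left associativity) : twocat_scope.
Notation "a ≡ b" := (eq2 a b) (at level 70, no associativity) : twocat_scope.
Local Open Scope twocat_scope.

Record is_monad (K : twocat) (C : K) (T : cell1 C C)
    (eta : one1 C ⇒ T) (mu : T · T ⇒ T) : Prop := IsMonad {
  monad_unitr : mu ∘ (T ⋆ eta) ≡ T;
  monad_unitl : mu ∘ (eta ⋆ T) ≡ T;
  monad_assoc : mu ∘ (T ⋆ mu) ≡ mu ∘ (mu ⋆ T)
}.

Record monad (K : twocat) (C : K) := Monad {
  monad_cell :> cell1 C C;
  eta : one1 C ⇒ monad_cell;
  mu : monad_cell · monad_cell ⇒ monad_cell;
  monadP : is_monad eta mu
}.

Arguments eta {K C} m.
Arguments mu {K C} m.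

Definition extension (K : twocat) (A C : K) (S : monad C) (F G : cell1 A C)
    (f : F ⇒ S · G) : S · F ⇒ S · G :=
  (mu S ⋆ G) ∘ (S ⋆ f).

Section Cells.

Context (K : twocat) (C : K) (S T : monad C).

(* The 2-cells usually written i : S => U and j : T => U. *)
Definition inl_cell (U : cell1 C C) (r : S · T ⇒ U) : S ⇒ U :=
  retype (r ∘ (S ⋆ eta T)).

Definition inr_cell (U : cell1 C C) (r : S · T ⇒ U) : T ⇒ U :=
  retype (r ∘ (eta S ⋆ T)).

Record distributing_retraction (U : monad C) (r : S · T ⇒ U) (s : U ⇒ S · T)
    : Prop := DistributingRetraction {
  dr_retract : r ∘ s ≡ U;
  dr_unit : r ∘ (eta S ⋆ eta T) ≡ eta U;
  dr_mul_l : r ∘ (mu S ⋆ T) ≡ mu U ∘ (inl_cell r ⋆ r);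
  dr_mul_r : r ∘ (S ⋆ mu T) ≡ mu U ∘ (r ⋆ inr_cell r);
  dr_idem_unit : (s ∘ r) ∘ (eta S ⋆ T) ≡ eta S ⋆ T;
  dr_idem_mul : (s ∘ r) ∘ (S ⋆ mu T) ≡ (S ⋆ mu T) ∘ ((s ∘ r) ⋆ T);
  dr_idem_ext :
    (s ∘ r) ∘ extension (s ∘ mu U ∘ (inr_cell r ⋆ U))
    ≡ extension (s ∘ mu U ∘ (inr_cell r ⋆ U)) ∘ ((s ∘ r) ⋆ U)
}.

Record weak_distributive_law (lam : T · S ⇒ S · T) : Prop :=
  WeakDistributiveLaw {
  wdl_unit : lam ∘ (T ⋆ eta S) ≡ eta S ⋆ T;
  wdl_mul_l : lam ∘ (T ⋆ mu S) ≡ (mu S ⋆ T) ∘ (S ⋆ lam) ∘ (lam ⋆ S);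
  wdl_mul_r : lam ∘ (mu T ⋆ S) ≡ (S ⋆ mu T) ∘ (lam ⋆ T) ∘ (T ⋆ lam)
}.

Definition wdl_idem (lam : T · S ⇒ S · T) : S · T ⇒ S · T :=
  retype ((S ⋆ mu T) ∘ (lam ⋆ T) ∘ (eta T ⋆ S ⋆ T)).

Definition splits (F U : cell1 C C) (e : F ⇒ F) (r : F ⇒ U) (s : U ⇒ F) : Prop :=
  r ∘ s ≡ U /\ s ∘ r ≡ e.

Definition wdl_of_retraction (U : monad C) (r : S · T ⇒ U) (s : U ⇒ S · T)
    : T · S ⇒ S · T :=
  s ∘ mu U ∘ (inr_cell r ⋆ inl_cell r).

Definition unit_of_wdl (U : cell1 C C) (r : S · T ⇒ U) : one1 C ⇒ U :=
  retype (r ∘ (eta S ⋆ eta T)).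

Definition mul_of_wdl (U : cell1 C C) (lam : T · S ⇒ S · T)
    (r : S · T ⇒ U) (s : U ⇒ S · T) : U · U ⇒ U :=
  r ∘ (mu S ⋆ mu T) ∘ (S ⋆ lam ⋆ T) ∘ (s ⋆ s).

End Cells.

Record retraction_tuple (K : twocat) (C : K) := RetractionTuple {
  rt_S : monad C;
  rt_T : monad C;
  rt_U : monad C;
  rt_r : rt_S · rt_T ⇒ rt_U;
  rt_s : rt_U ⇒ rt_S · rt_T;
  rt_retraction : distributing_retraction rt_r rt_s
}.

Record wdl_tuple (K : twocat) (C : K) := WdlTuple {
  wt_S : monad C;
  wt_T : monad C;
  wt_U : cell1 C C;
  wt_lam : wt_T · wt_S ⇒ wt_S · wt_T;
  wt_r : wt_S · wt_T ⇒ wt_U;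
  wt_s : wt_U ⇒ wt_S · wt_T;
  wt_wdl : weak_distributive_law wt_lam;
  wt_splits : splits (wdl_idem wt_lam) wt_r wt_s
}.

(* Main.v *)
Require Import Defs.
From Stdlib Require Import ssreflect ssrfun ProofIrrelevance.

(** Whiskering by the 1-cells X : C -> C turns a 1-cell F into the functor F· on
    the hom-category K(C, C) and a 2-cell into a natural family of arrows there;
    composites of functors are strictly associative by conversion, and taking
    X = 1 recovers the 2-cell, so it is enough to treat monads on an ordinary
    category.  From a retraction, i and j are monad morphisms, r is
    μU ∘ ij, and λ = s ∘ μU ∘ ji.  From a weak distributive law,
    κ = μS μT ∘ S λ T is associative with κ ∘ ST ηS ηT = ST and
    κ ∘ ηS ηT ST = e, whence e ∘ κ = κ ∘ e ST and κ ∘ ST e = κ; the product of U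
    is κ conjugated by r and s, that is μU ∘ rr = r ∘ κ. *)

Set Implicit Arguments.
Unset Strict Implicit.
Unset Printing Implicit Defensive.

Declare Scope category_scope.
Local Open Scope category_scope.

(** * Monads on an ordinary category *)

Record category := Category {
  ob :> Type;
  hom : ob -> ob -> Type;
  idm : forall X, hom X X;
  cmp : forall X Y Z, hom Y Z -> hom X Y -> hom X Z;
  cmpA : forall X Y Z W (h : hom Z W) (g : hom Y Z) (f : hom X Y),
    cmp h (cmp g f) = cmp (cmp h g) f;
  cmp1l : forall X Y (f : hom X Y), cmp (idm Y) f = f;
  cmp1r : forall X Y (f : hom X Y), cmp f (idm X) = f
}.

Arguments hom {c} X Y.
Arguments idm {c} X.
Arguments cmp {c X Y Z} g f : rename.

Notation "g ⊙ f" := (cmp g f) (at level 40, left associativity) : category_scope.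

Record functor (E : category) := Functor {
  fob :> E -> E;
  fmap : forall X Y, hom X Y -> hom (fob X) (fob Y);
  fmap_id : forall X, fmap (idm X) = idm (fob X);
  fmap_cmp : forall X Y Z (g : hom Y Z) (f : hom X Y),
    fmap (g ⊙ f) = fmap g ⊙ fmap f
}.

Arguments fmap {E} f {X Y} h : rename.
Notation "F ▹ h" := (fmap F h) (at level 35, right associativity) : category_scope.

Section Chains.

Context (E : category).

Lemma cmp_tail (X Y : E) (f g : hom X Y) :
  f = g -> forall Z (x : hom Z X), f ⊙ x = g ⊙ x.
Proof. by move=> ->. Qed.

(** The arbitrary tail [x] lets equations that were extended by a tail apply at the right end of a
    composite too. *)
Lemma cmp_ext (X Y : E) (f g : hom X Y) :
  (forall Z (x : hom Z X), f ⊙ x = g ⊙ x) -> f = g.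
Proof. by move=> /(_ X (idm X)); rewrite !cmp1r. Qed.

End Chains.

Ltac chain := rewrite ?fmap_cmp ?fmap_id -?cmpA ?cmp1l.

Ltac chain_in E := rewrite ?fmap_cmp ?fmap_id -?cmpA ?cmp1l in E.

(* [crw H] rewrites with an equation of arrows inside a right-nested chain: [H]
   is first extended by an arbitrary tail [x], so that both of its sides can be
   reassociated to the right. *)
Ltac tail_eq H E :=
  pose proof (fun Z (x : hom Z _) =>
    ltac:(let e := fresh in pose proof (cmp_tail H x) as e; chain_in e; exact e)) as E.

Tactic Notation "crw" constr(H) :=
  let E := fresh in tail_eq H E; rewrite E; clear E; chain.
Tactic Notation "crw" "<-" constr(H) :=
  let E := fresh in tail_eq H E; rewrite -E; clear E; chain.

Record monad_laws (E : category) (T : functor E)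
    (ret : forall X, hom X (T X)) (mul : forall X, hom (T (T X)) (T X)) : Prop :=
  MonadLaws {
  ml_unitr : forall X, mul X ⊙ T ▹ ret X = idm (T X);
  ml_unitl : forall X, mul X ⊙ ret (T X) = idm (T X);
  ml_assoc : forall X, mul X ⊙ T ▹ mul X = mul X ⊙ mul (T X)
}.

Record cat_monad (E : category) := CatMonad {
  cm_functor :> functor E;
  ret : forall X, hom X (cm_functor X);
  mul : forall X, hom (cm_functor (cm_functor X)) (cm_functor X);
  ret_nat : forall X Y (h : hom X Y), ret Y ⊙ h = cm_functor ▹ h ⊙ ret X;
  mul_nat : forall X Y (h : hom X Y),
    mul Y ⊙ cm_functor ▹ cm_functor ▹ h = cm_functor ▹ h ⊙ mul X;
  cm_laws : monad_laws ret mul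
}.

Arguments ret {E} c X.
Arguments mul {E} c X.

Section Components.

Context (E : category) (S T : cat_monad E) (U : functor E).
Context (etaU : forall X, hom X (U X)) (muU : forall X, hom (U (U X)) (U X)).
Context (r : forall X, hom (S (T X)) (U X)) (s : forall X, hom (U X) (S (T X))).
Context (lam : forall X, hom (T (S X)) (S (T X))).

Context (i : forall X, hom (S X) (U X)) (j : forall X, hom (T X) (U X)).

(** [U] is a bare functor with families [etaU] and [muU], so the laws make sense before these are
    shown to form a monad. [i] and [j] are variables fixed by equations, so that a proof can unfold
    them selectively. *)
Record retraction_laws : Prop := RetractionLaws {
  rl_inl : forall X, i X = r X ⊙ S ▹ ret T X;
  rl_inr : forall X, j X = r X ⊙ ret S (T X);
  rl_retract : forall X, r X ⊙ s X = idm (U X);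
  rl_unit : forall X, r X ⊙ (ret S (T X) ⊙ ret T X) = etaU X;
  rl_mul_l : forall X, r X ⊙ mul S (T X) = muU X ⊙ (i (U X) ⊙ S ▹ r X);
  rl_mul_r : forall X, r X ⊙ S ▹ mul T X = muU X ⊙ (r (U X) ⊙ S ▹ T ▹ j X);
  rl_idem_unit : forall X, (s X ⊙ r X) ⊙ ret S (T X) = ret S (T X);
  rl_idem_mul : forall X,
    (s X ⊙ r X) ⊙ S ▹ mul T X = S ▹ mul T X ⊙ (s (T X) ⊙ r (T X));
  rl_idem_ext : forall X,
    (s X ⊙ r X) ⊙ (mul S (T X) ⊙ S ▹ ((s X ⊙ muU X) ⊙ j (U X)))
    = (mul S (T X) ⊙ S ▹ ((s X ⊙ muU X) ⊙ j (U X))) ⊙ (s (U X) ⊙ r (U X))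
}.

Record wdl_laws : Prop := WdlLaws {
  wl_unit : forall X, lam X ⊙ T ▹ ret S X = ret S (T X);
  wl_mul_l : forall X,
    lam X ⊙ T ▹ mul S X = mul S (T X) ⊙ S ▹ lam X ⊙ lam (S X);
  wl_mul_r : forall X,
    lam X ⊙ mul T (S X) = S ▹ mul T X ⊙ lam (T X) ⊙ T ▹ lam X
}.

End Components.

(** * From distributing retractions to weak distributive laws, on an ordinary category *)

Section FromRetraction.

Context (E : category) (S T U : cat_monad E).
Context (r : forall X, hom (S (T X)) (U X)) (s : forall X, hom (U X) (S (T X))).
Hypothesis r_nat : forall X Y (h : hom X Y), r Y ⊙ S ▹ T ▹ h = U ▹ h ⊙ r X.
Hypothesis s_nat : forall X Y (h : hom X Y), s Y ⊙ U ▹ h = S ▹ T ▹ h ⊙ s X.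
Context (i : forall X, hom (S X) (U X)) (j : forall X, hom (T X) (U X)).
Context (lam : forall X, hom (T (S X)) (S (T X))).
Hypothesis rs : retraction_laws (ret U) (mul U) r s i j.
Hypothesis lamE : forall X, lam X = s X ⊙ mul U X ⊙ (j (U X) ⊙ T ▹ i X).

Let iE := rl_inl rs.
Let jE := rl_inr rs.

Local Lemma i_nat X Y (h : hom X Y) : i Y ⊙ S ▹ h = U ▹ h ⊙ i X.
Proof.
apply: cmp_ext => Z x; rewrite !iE; chain.
crw (f_equal (fmap S) (ret_nat T h)). by crw (r_nat h).
Qed.

Local Lemma j_nat X Y (h : hom X Y) : j Y ⊙ T ▹ h = U ▹ h ⊙ j X.
Proof.
apply: cmp_ext => Z x; rewrite !jE; chain.
crw (ret_nat S (T ▹ h)). by crw (r_nat h).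
Qed.

Local Lemma i_ret X : i X ⊙ ret S X = ret U X.
Proof.
apply: cmp_ext => Z x; rewrite !iE; chain.
crw <- (ret_nat S (ret T X)). by crw (rl_unit rs X).
Qed.

Local Lemma j_ret X : j X ⊙ ret T X = ret U X.
Proof. by rewrite jE -(rl_unit rs) cmpA. Qed.

(** Precompose [rl_mul_l] with SS ηT and use naturality of μS. *)
Local Lemma i_mul X : i X ⊙ mul S X = mul U X ⊙ (i (U X) ⊙ S ▹ i X).
Proof.
apply: cmp_ext => Z x; rewrite ![i X]iE; chain.
crw <- (mul_nat S (ret T X)). by crw (rl_mul_l rs X).
Qed.

(** Insert S of the identity μT ∘ ηT T after r and apply [rl_mul_r]; then r ∘ S ηT is i. *)
Local Lemma r_ij X : r X = mul U X ⊙ (i (U X) ⊙ S ▹ j X).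
Proof.
apply: cmp_ext => Z x; rewrite !iE; chain.
crw (f_equal (fmap S) (ret_nat T (j X))).
crw <- (rl_mul_r rs X). by crw (f_equal (fmap S) (ml_unitl (cm_laws T) X)).
Qed.

Local Lemma j_mul X : j X ⊙ mul T X = mul U X ⊙ (j (U X) ⊙ T ▹ j X).
Proof.
apply: cmp_ext => Z x; rewrite [j X in LHS]jE [j (U X)]jE; chain.
crw (ret_nat S (mul T X)). crw (rl_mul_r rs X).
by crw <- (ret_nat S (T ▹ j X)).
Qed.

Local Lemma s_j X : s X ⊙ j X = ret S (T X).
Proof. by rewrite jE cmpA (rl_idem_unit rs). Qed.

Local Lemma r_lam X : r X ⊙ lam X = mul U X ⊙ (j (U X) ⊙ T ▹ i X).
Proof.
apply: cmp_ext => Z x; rewrite !lamE; chain.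
by crw (rl_retract rs X).
Qed.

(** s respects the right actions of T, where T acts on U through j. Writing s as s ∘ r ∘ s exposes
    e, which commutes with S μT by [rl_idem_mul]. *)
Local Lemma mulT_s X : S ▹ mul T X ⊙ s (T X) = s X ⊙ (mul U X ⊙ U ▹ j X).
Proof.
apply: cmp_ext => Z x; chain.
have srs : s (T X) = s (T X) ⊙ (r (T X) ⊙ s (T X)).
  by rewrite (rl_retract rs) cmp1r.
crw srs.
crw <- (rl_idem_mul rs X). crw (rl_mul_r rs X). crw (r_nat (j X)).
by crw (rl_retract rs (T X)).
Qed.

Lemma retraction_wdl_laws : wdl_laws lam.
Proof.
have assocU := ml_assoc (cm_laws U).
split=> X; apply: cmp_ext => Z x; chain.
- rewrite lamE; chain. crw (f_equal (fmap T) (i_ret X)).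
  crw (j_nat (ret U X)). crw (ml_unitr (cm_laws U) X). by crw (s_j X).
(* λS absorbs e because it begins with s. The e so created meets the extension of s ∘ μU ∘ jU, and
   the last retraction axiom moves it to the outside; both sides are then s applied to the same
   product in U. *)
- have e_lam : lam (S X) = s (S X) ⊙ r (S X) ⊙ lam (S X).
    rewrite lamE -!cmpA; congr (_ ⊙ _); rewrite !cmpA.
    by rewrite (rl_retract rs) cmp1l.
  rewrite ![lam X]lamE; chain. crw e_lam.
  crw <- (s_nat (i X)). crw <- (r_nat (i X)). crw <- (rl_idem_ext rs X).
  crw (rl_mul_l rs X). crw (f_equal (fmap S) (rl_retract rs X)).
  crw (i_nat (mul U X)). crw (assocU X). crw <- (r_ij (U X)).
  crw (r_nat (i X)). crw (r_lam (S X)). crw <- (mul_nat U (i X)).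
  crw <- (j_nat (U ▹ i X)).
  crw (f_equal (fmap T) (i_mul X)). crw (j_nat (mul U X)). crw (assocU X).
  by crw (f_equal (fmap T) (i_nat (i X))).
(* Once S μT is moved past s, the i of λT and the new j combine to r by [r_ij], and r ∘ λ is again a
   product in U. *)
- rewrite [lam (T X)]lamE; chain. crw (mulT_s X).
  crw <- (mul_nat U (j X)). crw <- (j_nat (U ▹ j X)).
  crw <- (f_equal (fmap T) (i_nat (j X))). crw <- (assocU X).
  crw <- (j_nat (mul U X)). crw <- (f_equal (fmap T) (r_ij X)).
  crw (f_equal (fmap T) (r_lam X)).
  rewrite lamE; chain. crw <- (mul_nat T (i X)). crw (j_mul (U X)).
  crw <- (assocU X). by crw <- (j_nat (mul U X)).
Qed.

(** By the unit law of U, λ ∘ ηT S is s ∘ i = e ∘ S ηT; since e commutes with S μT, what remains is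
    e ∘ S(μT ∘ ηT T) = e. *)
Lemma retraction_idem X :
  s X ⊙ r X = S ▹ mul T X ⊙ lam (T X) ⊙ ret T (S (T X)).
Proof.
apply: cmp_ext => Z x; rewrite lamE; chain.
crw <- (ret_nat T (i (T X))). crw (j_ret (U (T X))).
crw (ml_unitl (cm_laws U) (T X)). rewrite iE; chain.
crw <- (rl_idem_mul rs X).
by crw (f_equal (fmap S) (ml_unitl (cm_laws T) X)).
Qed.

Lemma retraction_mul X :
  r X ⊙ (mul S (T X) ⊙ S ▹ S ▹ mul T X) ⊙ S ▹ lam (T X)
    ⊙ (s (S (T X)) ⊙ U ▹ s X) = mul U X.
Proof.
have assocU := ml_assoc (cm_laws U).
(* This is r ∘ κ = μU ∘ rr: both sides are the fourfold product of i, j, i, j in U, the middle pair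
   arising from r ∘ λ = μU ∘ ji. *)
have rk : r X ⊙ (mul S (T X) ⊙ S ▹ S ▹ mul T X) ⊙ S ▹ lam (T X)
    = mul U X ⊙ (r (U X) ⊙ S ▹ T ▹ r X).
  apply: cmp_ext => Z x; chain.
  crw (rl_mul_l rs X). crw (f_equal (fmap S) (rl_mul_r rs X)).
  crw (f_equal (fmap S) (r_nat (j X))).
  crw (f_equal (fmap S) (r_lam (T X))).
  crw <- (f_equal (fmap S) (mul_nat U (j X))).
  crw <- (f_equal (fmap S) (j_nat (U ▹ j X))).
  crw <- (f_equal (fun h => S ▹ T ▹ h) (i_nat (j X))).
  crw <- (f_equal (fmap S) (assocU X)).
  crw <- (f_equal (fmap S) (j_nat (mul U X))).
  crw <- (f_equal (fun h => S ▹ T ▹ h) (r_ij X)).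
  crw (i_nat (mul U X)). crw (assocU X).
  by crw <- (r_ij (U X)).
rewrite rk; apply: cmp_ext => Z x; chain.
crw <- (s_nat (r X)). crw (rl_retract rs (U X)).
by crw (f_equal (fmap U) (rl_retract rs X)).
Qed.

End FromRetraction.

(** * From weak distributive laws to distributing retractions, on an ordinary category *)

Section FromWdl.

Context (E : category) (S T : cat_monad E) (U : functor E).
Context (r : forall X, hom (S (T X)) (U X)) (s : forall X, hom (U X) (S (T X))).
Context (lam : forall X, hom (T (S X)) (S (T X))).
Hypothesis r_nat : forall X Y (h : hom X Y), r Y ⊙ S ▹ T ▹ h = U ▹ h ⊙ r X.
Hypothesis s_nat : forall X Y (h : hom X Y), s Y ⊙ U ▹ h = S ▹ T ▹ h ⊙ s X.
Hypothesis lam_nat :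
  forall X Y (h : hom X Y), lam Y ⊙ T ▹ S ▹ h = S ▹ T ▹ h ⊙ lam X.
Hypothesis wl : wdl_laws lam.
Hypothesis retract : forall X, r X ⊙ s X = idm (U X).
Hypothesis idem : forall X,
  s X ⊙ r X = S ▹ mul T X ⊙ lam (T X) ⊙ ret T (S (T X)).

Context (etaU : forall X, hom X (U X)) (muU : forall X, hom (U (U X)) (U X)).
Hypothesis etaE : forall X, r X ⊙ (ret S (T X) ⊙ ret T X) = etaU X.
Hypothesis muE : forall X,
  r X ⊙ (mul S (T X) ⊙ S ▹ S ▹ mul T X) ⊙ S ▹ lam (T X)
    ⊙ (s (S (T X)) ⊙ U ▹ s X) = muU X.
Context (i : forall X, hom (S X) (U X)) (j : forall X, hom (T X) (U X)).
Hypothesis iE : forall X, i X = r X ⊙ S ▹ ret T X.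
Hypothesis jE : forall X, j X = r X ⊙ ret S (T X).

Let lawS := cm_laws S.
Let lawT := cm_laws T.

(* The multiplication ST would carry if [lam] were a distributive law: it is
   associative and right unital, but left multiplication by the unit is the
   idempotent s r. *)
Definition pre_mul X : hom (S (T (S (T X)))) (S (T X)) :=
  mul S (T X) ⊙ S ▹ S ▹ mul T X ⊙ S ▹ lam (T X).

Local Lemma pre_mul_nat X Y (h : hom X Y) :
  pre_mul Y ⊙ S ▹ T ▹ S ▹ T ▹ h = S ▹ T ▹ h ⊙ pre_mul X.
Proof.
apply: cmp_ext => Z x; rewrite /pre_mul; chain.
crw (f_equal (fmap S) (lam_nat (T ▹ h))).
crw (f_equal (fun h => S ▹ S ▹ h) (mul_nat T h)).
by crw (mul_nat S (T ▹ h)).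
Qed.

(** As for an ordinary distributive law: [wl_mul_l] rewrites one bracketing, [wl_mul_r] the other,
    and naturality with associativity of S and T makes them meet. *)
Local Lemma pre_mulA X :
  pre_mul X ⊙ S ▹ T ▹ pre_mul X = pre_mul X ⊙ pre_mul (S (T X)).
Proof.
apply: cmp_ext => Z x; rewrite /pre_mul; chain.
crw (f_equal (fmap S) (wl_mul_l wl (T X))).
crw (f_equal (fmap S) (lam_nat (S ▹ mul T X))).
crw (f_equal (fun h => S ▹ S ▹ h) (lam_nat (mul T X))).
crw <- (f_equal (fmap S) (mul_nat S (mul T X))).
crw (ml_assoc lawS (T X)).
crw (f_equal (fun h => S ▹ S ▹ S ▹ h) (ml_assoc lawT X)).
crw <- (mul_nat S (lam (T X))).
crw (f_equal (fun h => S ▹ S ▹ h) (wl_mul_r wl (T X))).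
crw <- (f_equal (fmap S) (lam_nat (lam (T X)))).
by crw <- (mul_nat S (S ▹ mul T X)).
Qed.

Local Lemma pre_mul_unitr X :
  pre_mul X ⊙ S ▹ T ▹ (ret S (T X) ⊙ ret T X) = idm (S (T X)).
Proof.
apply: cmp_ext => Z x; rewrite /pre_mul; chain.
crw (f_equal (fmap S) (wl_unit wl (T X))).
crw <- (f_equal (fmap S) (ret_nat S (mul T X))).
crw (f_equal (fmap S) (ml_unitr lawT X)).
by crw (ml_unitr lawS (T X)).
Qed.

Local Lemma pre_mul_unitl X :
  pre_mul X ⊙ (ret S (T (S (T X))) ⊙ ret T (S (T X))) = s X ⊙ r X.
Proof.
rewrite idem; apply: cmp_ext => Z x; rewrite /pre_mul; chain.
crw <- (ret_nat S (lam (T X))). crw <- (ret_nat S (S ▹ mul T X)).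
by crw (ml_unitl lawS (T X)).
Qed.

(** Since e is left multiplication by the unit, this is associativity of κ with the unit in the
    first place. *)
Local Lemma idem_pre_mul X :
  s X ⊙ r X ⊙ pre_mul X = pre_mul X ⊙ (s (S (T X)) ⊙ r (S (T X))).
Proof.
rewrite -!pre_mul_unitl; apply: cmp_ext => Z x; chain.
crw (ret_nat T (pre_mul X)). crw (ret_nat S (T ▹ pre_mul X)).
by crw (pre_mulA X).
Qed.

(** Associativity with the unit in the middle place: the unit moves to the right of the first
    factor, where it cancels. *)
Local Lemma pre_mul_idem X : pre_mul X ⊙ S ▹ T ▹ (s X ⊙ r X) = pre_mul X.
Proof.
rewrite -pre_mul_unitl; apply: cmp_ext => Z x; chain.
crw (pre_mulA X). by crw (pre_mul_unitr (S (T X))).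
Qed.

Local Lemma r_pre_mul X :
  r X ⊙ pre_mul X ⊙ (s (S (T X)) ⊙ r (S (T X))) = r X ⊙ pre_mul X.
Proof.
apply: cmp_ext => Z x; chain. crw <- (idem_pre_mul X).
by crw (retract X).
Qed.

Local Lemma muE' X : muU X = r X ⊙ pre_mul X ⊙ (s (S (T X)) ⊙ U ▹ s X).
Proof. by rewrite -muE /pre_mul -!cmpA. Qed.

(** r carries κ to the product of U: by naturality the left side is r ∘ κ with e inserted in each
    factor, and both copies are absorbed. *)
Local Lemma mu_rr X : muU X ⊙ (r (U X) ⊙ S ▹ T ▹ r X) = r X ⊙ pre_mul X.
Proof.
apply: cmp_ext => Z x; rewrite muE'; chain.
crw <- (r_nat (s X)). crw (r_pre_mul X). by crw (pre_mul_idem X).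
Qed.

Local Lemma idem_ret X : s X ⊙ r X ⊙ ret S (T X) = ret S (T X).
Proof.
rewrite idem; apply: cmp_ext => Z x; chain.
crw (ret_nat T (ret S (T X))). crw (wl_unit wl (T X)).
crw <- (ret_nat S (mul T X)). by crw (ml_unitl lawT X).
Qed.

Local Lemma idem_ret_r X : s X ⊙ r X ⊙ S ▹ ret T X = lam X ⊙ ret T (S X).
Proof.
rewrite idem; apply: cmp_ext => Z x; chain.
crw (ret_nat T (S ▹ ret T X)). crw (lam_nat (ret T X)).
by crw (f_equal (fmap S) (ml_unitr lawT X)).
Qed.

(** A formula through λ for the 2-cell whose extension enters the last retraction axiom. The factor
    ηS coming from j is fixed by e and cancels the μS in κ. *)
Local Lemma s_mu_j X :
  s X ⊙ muU X ⊙ j (U X) = S ▹ mul T X ⊙ lam (T X) ⊙ T ▹ s X.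
Proof.
apply: cmp_ext => Z x; rewrite jE muE'; chain.
crw <- (r_nat (s X)). crw (r_pre_mul X). crw (idem_pre_mul X).
crw <- (ret_nat S (T ▹ s X)). crw (idem_ret (S (T X))).
rewrite /pre_mul; chain.
crw <- (ret_nat S (lam (T X))). crw <- (ret_nat S (S ▹ mul T X)).
by crw (ml_unitl lawS (T X)).
Qed.

Lemma wdl_monad_laws : monad_laws etaU muU.
Proof.
split=> X.
- apply: cmp_ext => Z x; rewrite muE' -etaE; chain.
  crw (f_equal (fmap U) (idem_ret X)).
  crw (s_nat (ret S (T X))). crw (s_nat (ret T X)).
  crw (pre_mul_unitr X). by crw (retract X).
- apply: cmp_ext => Z x; rewrite muE' -etaE; chain.
  crw <- (r_nat (s X)). crw (r_pre_mul X).
  crw <- (ret_nat S (T ▹ s X)). crw <- (ret_nat T (s X)).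
  crw (pre_mul_unitl X). crw (retract X). by crw (retract X).
(* rrr is a split epimorphism, so associativity may be checked after precomposing with it; there
   [mu_rr] reduces it to associativity of κ. *)
- have split_epi : r (U (U X)) ⊙ S ▹ T ▹ r (U X) ⊙ S ▹ T ▹ S ▹ T ▹ r X
     ⊙ (S ▹ T ▹ S ▹ T ▹ s X ⊙ (S ▹ T ▹ s (U X) ⊙ s (U (U X))))
     = idm (U (U (U X))).
    apply: cmp_ext => Z x; chain.
    crw (f_equal (fun h => S ▹ T ▹ S ▹ T ▹ h) (retract X)).
    crw (f_equal (fun h => S ▹ T ▹ h) (retract (U X))).
    by crw (retract (U (U X))).
  rewrite -[LHS]cmp1r -[RHS]cmp1r -split_epi !cmpA; do 3 congr (_ ⊙ _).
  apply: cmp_ext => Z x; chain.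
  crw <- (r_nat (muU X)). crw (f_equal (fun h => S ▹ T ▹ h) (mu_rr X)).
  crw (mu_rr X). crw (pre_mulA X).
  crw (mu_rr (U X)). crw (pre_mul_nat (r X)). by crw (mu_rr X).
Qed.

Lemma wdl_retraction_laws : retraction_laws etaU muU r s i j.
Proof.
split=> // X; apply: cmp_ext => Z x.
(* μS T and κ ∘ S ηT ST are compared after applying e: moving e inside κ turns e ∘ S ηT into λ ∘ ηT
   S, and [wl_mul_l] applies. Composing with r then replaces e by r. *)
- have e_mul : s X ⊙ r X ⊙ mul S (T X)
      = s X ⊙ r X ⊙ pre_mul X ⊙ S ▹ ret T (S (T X)).
    rewrite idem_pre_mul; apply: cmp_ext => W y; chain.
    crw (idem_ret_r (S (T X))). crw (idem X). rewrite /pre_mul; chain.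
    crw (ret_nat T (mul S (T X))). crw (wl_mul_l wl (T X)).
    by crw (mul_nat S (mul T X)).
  have r_mul : r X ⊙ mul S (T X) = r X ⊙ pre_mul X ⊙ S ▹ ret T (S (T X)).
    by have := f_equal (cmp (r X)) e_mul; rewrite !cmpA !retract !cmp1l.
  rewrite iE; chain. crw (f_equal (fmap S) (ret_nat T (r X))).
  crw (mu_rr X). by crw r_mul.
- rewrite jE; chain. crw (mu_rr X). rewrite /pre_mul; chain.
  crw (f_equal (fmap S) (wl_unit wl (T X))).
  crw <- (f_equal (fmap S) (ret_nat S (mul T X))).
  by crw (ml_unitr lawS (T X)).
- by chain; crw (idem_ret X).
- rewrite !idem; chain.
  crw (ret_nat T (S ▹ mul T X)). crw (lam_nat (mul T X)).
  by crw (f_equal (fmap S) (ml_assoc lawT X)).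
(* By [s_mu_j] the extension is κ ∘ ST s, so the axiom follows from [idem_pre_mul] and naturality of
   r and s. *)
- rewrite s_mu_j; chain.
  crw (idem_pre_mul X).
  crw (r_nat (s X)). by crw (s_nat (s X)).
Qed.

(** With [s_mu_j] and s ∘ i = λ ∘ ηT S the composite becomes S μT ∘ λT ∘ Tλ ∘ T ηT S, which is λ ∘
    μT S ∘ T ηT S by [wl_mul_r]. *)
Lemma wdl_recover X : s X ⊙ muU X ⊙ (j (U X) ⊙ T ▹ i X) = lam X.
Proof.
apply: cmp_ext => Z x; rewrite iE; chain. crw (s_mu_j X).
crw (f_equal (fmap T) (idem_ret_r X)).
crw <- (wl_mul_r wl X). by crw (ml_unitr lawT (S X)).
Qed.

End FromWdl.

Local Open Scope twocat_scope.

(** * Components of 2-cells *)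

Section StrictEquality.

Context (K : twocat) (A B : K).

Lemma eq2_refl (F G : cell1 A B) (a : F ⇒ G) : a ≡ a.
Proof. by exists erefl, erefl. Qed.

Lemma eq2_sym (F G F' G' : cell1 A B) (a : F ⇒ G) (b : F' ⇒ G') :
  a ≡ b -> b ≡ a.
Proof. by case=> p [q <-]; case: _ / p; case: _ / q; apply: eq2_refl. Qed.

Lemma eq2_trans (F G F' G' F'' G'' : cell1 A B)
    (a : F ⇒ G) (b : F' ⇒ G') (c : F'' ⇒ G'') : a ≡ b -> b ≡ c -> a ≡ c.
Proof.
case=> p [q <-] [p' [q' <-]].
case: _ / p' ; case: _ / q'; case: _ / p; case: _ / q; exact: eq2_refl.
Qed.

Lemma eq2_eq (F G : cell1 A B) (a b : F ⇒ G) : a ≡ b -> a = b.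
Proof.
by case=> p [q <-]; rewrite (proof_irrelevance _ p erefl)
  (proof_irrelevance _ q erefl).
Qed.

Lemma eq2_cast (F G F' G' : cell1 A B) (p : F = F') (q : G = G') (a : F ⇒ G) :
  cast p q a ≡ a.
Proof. by case: _ / p; case: _ / q; apply: eq2_refl. Qed.

Lemma eq2_vcomp (F G H F' G' H' : cell1 A B)
    (b : G ⇒ H) (a : F ⇒ G) (b' : G' ⇒ H') (a' : F' ⇒ G') :
  b ≡ b' -> a ≡ a' -> vcomp b a ≡ vcomp b' a'.
Proof.
case=> p [q <-] [p' [q' <-]]; rewrite (proof_irrelevance _ q' p).
case: _ / q; case: _ / p'; case: _ / p; exact: eq2_refl.
Qed.

Lemma eq2_svcomp (F G G0 H F' G' H' : cell1 A B) (b : G0 ⇒ H) (a : F ⇒ G)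
    (p : strict_eq G G0) (b' : G' ⇒ H') (a' : F' ⇒ G') :
  b ≡ b' -> a ≡ a' -> b ∘ a ≡ vcomp b' a'.
Proof.
move=> hb ha; apply: eq2_vcomp => //.
exact: eq2_trans (eq2_cast _ _ _) ha.
Qed.

End StrictEquality.

Lemma eq2_hcomp (K : twocat) (A B D : K) (G G' H H' : cell1 B D)
    (F F' L L' : cell1 A B) (b : G ⇒ G') (a : F ⇒ F') (b' : H ⇒ H') (a' : L ⇒ L') :
  b ≡ b' -> a ≡ a' -> b ⋆ a ≡ b' ⋆ a'.
Proof.
case=> p [q <-] [p' [q' <-]].
case: _ / p; case: _ / q; case: _ / p'; case: _ / q'; exact: eq2_refl.
Qed.

Definition hom_category (K : twocat) (A B : K) : category :=
  @Category (cell1 A B) (fun F G => F ⇒ G) (fun F => one2 F)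
    (fun _ _ _ b a => vcomp b a) (@vcompA K A B) (@vcomp_1l K A B)
    (@vcomp_1r K A B).

Section Components.

Context (K : twocat) (C : K).

Local Notation E := (hom_category C C).

Definition post (F : cell1 C C) : functor E.
Proof.
refine (@Functor E (fun X => F · X) (fun X Y h => F ⋆ h) _ _).
- by move=> X; apply: hcomp_one2.
- by move=> X Y Z g f /=; rewrite -hcomp_vcomp vcomp_1l.
Defined.

(* 2-cells become natural families between iterated applications of [post],
   where composition of 1-cells is strictly associative by conversion. *)
Definition has_components (F G : cell1 C C) (a : F ⇒ G) (f g : E -> E)
    (phi : forall X, hom (f X) (g X)) : Prop :=
  forall X : cell1 C C, a ⋆ X ≡ phi X.

(** The counterpart for 1-cells: [one1 C] is represented by the identity and a composite by iterated
    functors, without unitors or associators. *)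
Definition has_action (F : cell1 C C) (f : E -> E)
    (fm : forall X Y, hom X Y -> hom (f X) (f Y)) : Prop :=
  forall (X Y : cell1 C C) (h : X ⇒ Y), F ⋆ h ≡ fm X Y h.

Lemma action_post (F : cell1 C C) : has_action F (@fmap _ (post F)).
Proof. by move=> X Y h; apply: eq2_refl. Qed.

Lemma action_one1 : has_action (one1 C) (fun (X Y : E) (h : hom X Y) => h).
Proof.
move=> X Y h; rewrite -[X in _ ≡ X](hcomp_1l h).
exact/eq2_sym/eq2_cast.
Qed.

Lemma action_comp1 (F G : cell1 C C) (f g : E -> E)
    (fm : forall X Y, hom X Y -> hom (f X) (f Y))
    (gm : forall X Y, hom X Y -> hom (g X) (g Y)) :
  has_action F fm -> has_action G gm ->
  has_action (F · G) (fun X Y h => fm _ _ (gm X Y h)).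
Proof.
move=> hF hG X Y h; rewrite -hcomp_one2 -hcompA.
apply: eq2_trans (eq2_cast _ _ _) _.
exact: eq2_trans (eq2_hcomp (eq2_refl _) (hG _ _ h)) (hF _ _ _).
Qed.

Lemma components_one2 (F : cell1 C C) :
  has_components F (fun X : E => idm (post F X)).
Proof. by move=> X; rewrite hcomp_one2; apply: eq2_refl. Qed.

Lemma components_retype (F G F' G' : cell1 C C) (a : F ⇒ G)
    (p : strict_eq F F') (q : strict_eq G G') (f g : E -> E)
    (phi : forall X, hom (f X) (g X)) :
  has_components a phi -> has_components (retype a (p := p) (q := q)) phi.
Proof.
move=> ha X; apply: eq2_trans (ha X).
exact: eq2_hcomp (eq2_cast _ _ _) (eq2_refl _).
Qed.

Lemma components_svcomp (F G G' H : cell1 C C) (b : G' ⇒ H) (a : F ⇒ G)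
    (p : strict_eq G G') (f g h : E -> E)
    (psi : forall X, hom (g X) (h X)) (phi : forall X, hom (f X) (g X)) :
  has_components b psi -> has_components a phi ->
  has_components (b ∘ a) (fun X => psi X ⊙ phi X).
Proof.
move=> hb ha X; rewrite /svcomp -(vcomp_1l (one2 X)) hcomp_vcomp.
apply: eq2_vcomp => //; apply: eq2_trans (ha X).
exact: eq2_hcomp (eq2_cast _ _ _) (eq2_refl _).
Qed.

(** By interchange, b ⋆ a is G ⋆ a followed by b whiskered with F'. *)
Lemma components_hcomp (G G' F F' : cell1 C C) (b : G ⇒ G') (a : F ⇒ F')
    (f f' g g' : E -> E) (gm : forall X Y, hom X Y -> hom (g X) (g Y))
    (psi : forall X, hom (g X) (g' X)) (phi : forall X, hom (f X) (f' X)) :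
  has_action G gm -> has_components b psi -> has_components a phi ->
  has_components (b ⋆ a) (fun X => psi (f' X) ⊙ gm _ _ (phi X)).
Proof.
move=> hG hb ha X.
rewrite -hcompA; apply: eq2_trans (eq2_cast _ _ _) _.
apply: eq2_trans (eq2_hcomp (eq2_refl b) (ha X)) _.
rewrite -(vcomp_1r b) -{1}(vcomp_1l (phi X)) hcomp_vcomp.
exact: eq2_vcomp (hb _) (hG _ _ _).
Qed.

(** This and the next two lemmas omit the identity factor that [components_hcomp] would produce, so
    that components have the shape used in the laws. *)
Lemma components_whiskerl (F G H : cell1 C C) (a : G ⇒ H) (g h : E -> E)
    (phi : forall X, hom (g X) (h X)) :
  has_components a phi ->
  has_components (F ⋆ a) (fun X => post F ▹ phi X).
Proof.
move=> ha X; rewrite -hcompA; apply: eq2_trans (eq2_cast _ _ _) _.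
exact: eq2_hcomp (eq2_refl _) (ha X).
Qed.

Lemma components_whiskerr (F G H : cell1 C C) (a : G ⇒ H) (g h : E -> E)
    (phi : forall X, hom (g X) (h X)) :
  has_components a phi ->
  has_components (a ⋆ F) (fun X => phi (post F X)).
Proof.
move=> ha X; rewrite -hcompA; apply: eq2_trans (eq2_cast _ _ _) _.
by rewrite hcomp_one2; apply: ha.
Qed.

Lemma components_whiskerr2 (F F' G H : cell1 C C) (a : G ⇒ H) (g h : E -> E)
    (phi : forall X, hom (g X) (h X)) :
  has_components a phi ->
  has_components (a ⋆ F ⋆ F') (fun X => phi (post F (post F' X))).
Proof.
move=> ha X; rewrite -hcompA; apply: eq2_trans (eq2_cast _ _ _) _.
rewrite hcomp_one2; apply: eq2_trans (ha _).
apply: eq2_hcomp (eq2_refl _) _.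
by rewrite -hcomp_one2 -hcompA !hcomp_one2; apply: eq2_cast.
Qed.

Lemma components_eq (F G F' G' : cell1 C C) (a : F ⇒ G) (b : F' ⇒ G')
    (f g : E -> E) (phi psi : forall X, hom (f X) (g X)) :
  has_components a phi -> has_components b psi ->
  a ≡ b -> forall X, phi X = psi X.
Proof.
move=> ha hb ab X; apply: eq2_eq.
apply: eq2_trans (eq2_sym (ha X)) (eq2_trans _ (hb X)).
exact: eq2_hcomp ab (eq2_refl _).
Qed.

Lemma eq2_of_components (F G F' G' : cell1 C C) (a : F ⇒ G) (b : F' ⇒ G')
    (f g : E -> E) (phi psi : forall X, hom (f X) (g X)) :
  has_components a phi -> has_components b psi ->
  (forall X, phi X = psi X) -> a ≡ b.
Proof.
move=> ha hb ab.
have unitr (H L : cell1 C C) (c : H ⇒ L) : c ⋆ one1 C ≡ c.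
  by rewrite -[X in _ ≡ X]hcomp_1r; apply/eq2_sym/eq2_cast.
apply: eq2_trans (eq2_sym (unitr _ _ a)) (eq2_trans (ha _) _).
by rewrite ab; apply: eq2_trans (eq2_sym (hb _)) (unitr _ _ b).
Qed.

(** Naturality is the interchange law: both sides are factorizations of a ⋆ h. *)
Lemma components_natural (F G : cell1 C C) (a : F ⇒ G) (f g : E -> E)
    (fm : forall X Y, hom X Y -> hom (f X) (f Y))
    (gm : forall X Y, hom X Y -> hom (g X) (g Y))
    (phi : forall X, hom (f X) (g X)) :
  has_action F fm -> has_action G gm -> has_components a phi ->
  forall (X Y : E) (h : hom X Y),
    phi Y ⊙ fm X Y h = gm X Y h ⊙ phi X.
Proof.
move=> hF hG ha X Y h; apply: eq2_eq.
have := erefl (a ⋆ h).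
rewrite -[in LHS](vcomp_1r a) -[in LHS](vcomp_1l h) hcomp_vcomp.
rewrite -[in RHS](vcomp_1l a) -[in RHS](vcomp_1r h) hcomp_vcomp => e.
apply: eq2_trans (eq2_sym (eq2_vcomp (ha Y) (hF X Y h))) _.
by rewrite e; apply: eq2_vcomp.
Qed.

(** The whiskering is transported to a chosen boundary, typically iterated applications of [post],
    so that components compose by conversion. *)
Definition components (F G : cell1 C C) (a : F ⇒ G) (f g : E -> E)
    (p : forall X : cell1 C C, strict_eq (F · X) (f X))
    (q : forall X : cell1 C C, strict_eq (G · X) (g X)) X : hom (f X) (g X) :=
  cast (p X) (q X) (a ⋆ one2 X).

Lemma componentsP (F G : cell1 C C) (a : F ⇒ G) (f g : E -> E)
    (p : forall X : cell1 C C, strict_eq (F · X) (f X))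
    (q : forall X : cell1 C C, strict_eq (G · X) (g X)) :
  has_components a (components a p q).
Proof. by move=> X; apply/eq2_sym/eq2_cast. Qed.

End Components.

Ltac action_of F :=
  lazymatch F with
  | comp1 ?F1 ?F2 =>
      let h1 := action_of F1 in let h2 := action_of F2 in
      constr:(action_comp1 h1 h2)
  | one1 ?C => constr:(@action_one1 _ C)
  | _ => constr:(action_post F)
  end.

(** Recursion on the shape of a pasting: whiskerings are matched before general horizontal
    composites, and atoms are looked up among the hypotheses. *)
Ltac components_of a :=
  lazymatch a with
  | @svcomp _ _ _ _ _ _ _ ?b ?a ?p =>
      let hb := components_of b in let ha := components_of a in
      constr:(components_svcomp p hb ha)
  | @retype _ _ _ _ _ _ _ ?a ?p ?q =>
      let ha := components_of a in constr:(components_retype p q ha)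
  | hcomp ?a (hcomp (one2 ?F) (one2 ?G)) =>
      let ha := components_of a in constr:(components_whiskerr2 F G ha)
  | hcomp (one2 ?F) ?a =>
      let ha := components_of a in constr:(components_whiskerl F ha)
  | hcomp ?a (one2 ?F) =>
      let ha := components_of a in constr:(components_whiskerr F ha)
  | @hcomp _ _ _ _ ?G _ _ _ ?b ?a =>
      let hG := action_of G in
      let hb := components_of b in let ha := components_of a in
      constr:(components_hcomp hG hb ha)
  | one2 ?F => constr:(components_one2 F)
  | extension _ => let a' := eval unfold extension in a in components_of a'
  | _ => lazymatch goal with h : has_components a _ |- _ => h end
  end.

(** The components read off the two sides agree by conversion with those in the categorical law, so
    [exact] suffices. *)
Ltac to_components h :=
  lazymatch type of h with
  | eq2 ?a ?b => let ha := components_of a in let hb := components_of b in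
                 exact (components_eq ha hb h)
  end.
Ltac of_components h :=
  lazymatch goal with
  | |- eq2 ?a ?b => let ha := components_of a in let hb := components_of b in
                 exact (eq2_of_components ha hb h)
  end.

(** * The axioms on 2-cells as axioms on their components *)

Section Translation.

Context (K : twocat) (C : K).

Local Notation E := (hom_category C C).

Lemma is_monad_components (F : cell1 C C) (eta : one1 C ⇒ F) (mu : F · F ⇒ F)
    (etac : forall X : E, hom X (post F X))
    (muc : forall X : E, hom (post F (post F X)) (post F X)) :
  has_components eta etac -> has_components mu muc ->
  is_monad eta mu <-> monad_laws etac muc.
Proof.
move=> he hm; split=> [[h1 h2 h3]|[h1 h2 h3]]; split.
- to_components h1.
- to_components h2.
- to_components h3.
- of_components h1.
- of_components h2.
- of_components h3.
Qed.

Definition unit_components (F : cell1 C C) (eta : one1 C ⇒ F) (X : E) :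
  hom X (post F X) := components eta (@comp1_1l K C C) (fun=> erefl) X.

Definition mul_components (F : cell1 C C) (mu : F · F ⇒ F) (X : E) :
    hom (post F (post F X)) (post F X) :=
  components mu (fun X => esym (comp1A F F X)) (fun=> erefl) X.

Lemma unit_componentsP (F : cell1 C C) (eta : one1 C ⇒ F) :
  has_components eta (unit_components eta).
Proof. exact: componentsP. Qed.

Lemma mul_componentsP (F : cell1 C C) (mu : F · F ⇒ F) :
  has_components mu (mul_components mu).
Proof. exact: componentsP. Qed.

Lemma unit_components_nat (F : cell1 C C) (eta : one1 C ⇒ F) (X Y : E)
    (h : hom X Y) :
  unit_components eta Y ⊙ h = post F ▹ h ⊙ unit_components eta X.
Proof.
exact (components_natural (@action_one1 K C) (action_post F)
  (unit_componentsP eta) h).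
Qed.

Lemma mul_components_nat (F : cell1 C C) (mu : F · F ⇒ F) (X Y : E)
    (h : hom X Y) :
  mul_components mu Y ⊙ post F ▹ post F ▹ h
  = post F ▹ h ⊙ mul_components mu X.
Proof.
exact (components_natural (action_comp1 (action_post F) (action_post F))
  (action_post F) (mul_componentsP mu) h).
Qed.

Definition cat_monad_of (T : monad C) : cat_monad E :=
  CatMonad (@unit_components_nat T (eta T)) (@mul_components_nat T (mu T))
    (proj1 (is_monad_components (unit_componentsP _) (mul_componentsP _))
       (monadP T)).

Context (S T : monad C) (U : cell1 C C).
Context (r : S · T ⇒ U) (s : U ⇒ S · T).

Local Notation S' := (cat_monad_of S).
Local Notation T' := (cat_monad_of T).
Local Notation U' := (post U).

Definition retr_components (X : E) : hom (S' (T' X)) (U' X) :=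
  components r (fun X => esym (comp1A S T X)) (fun=> erefl) X.

Definition sec_components (X : E) : hom (U' X) (S' (T' X)) :=
  components s (fun=> erefl) (fun X => esym (comp1A S T X)) X.

Local Notation r' := retr_components.
Local Notation s' := sec_components.

(** An explicit formula, as for [inr_components], makes [rl_inl] and [rl_inr] hold by
    reflexivity. *)
Definition inl_components X : hom (S' X) (U' X) :=
  r' X ⊙ S' ▹ ret T' X.

Definition inr_components X : hom (T' X) (U' X) :=
  r' X ⊙ ret S' (T' X).

Let hr : has_components r r' := componentsP _ _ _.
Let hs : has_components s s' := componentsP _ _ _.
Let hetaS : has_components (eta S) (ret S') := unit_componentsP _.
Let hetaT : has_components (eta T) (ret T') := unit_componentsP _.
Let hmuS : has_components (mu S) (mul S') := mul_componentsP _.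
Let hmuT : has_components (mu T) (mul T') := mul_componentsP _.

Lemma retr_nat (X Y : E) (h : hom X Y) :
  r' Y ⊙ S' ▹ T' ▹ h = U' ▹ h ⊙ r' X.
Proof.
exact (components_natural (action_comp1 (action_post S) (action_post T))
  (action_post U) hr h).
Qed.

Lemma sec_nat (X Y : E) (h : hom X Y) :
  s' Y ⊙ U' ▹ h = S' ▹ T' ▹ h ⊙ s' X.
Proof.
exact (components_natural (action_post U)
  (action_comp1 (action_post S) (action_post T)) hs h).
Qed.

Lemma inl_componentsP : has_components (inl_cell r) inl_components.
Proof.
rewrite /inl_cell; match goal with |- has_components ?a _ =>
  let h := components_of a in exact h end.
Qed.

Lemma inr_componentsP : has_components (inr_cell r) inr_components.
Proof.
rewrite /inr_cell; match goal with |- has_components ?a _ =>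
  let h := components_of a in exact h end.
Qed.

Let hinl := inl_componentsP.
Let hinr := inr_componentsP.

Lemma wdl_components (lam : T · S ⇒ S · T)
    (lam' : forall X, hom (T' (S' X)) (S' (T' X))) :
  has_components lam lam' -> weak_distributive_law lam <-> wdl_laws lam'.
Proof.
move=> hl; split=> [[h1 h2 h3]|[h1 h2 h3]]; split.
- to_components h1.
- to_components h2.
- to_components h3.
- of_components h1.
- of_components h2.
- of_components h3.
Qed.

Lemma splits_components (lam : T · S ⇒ S · T)
    (lam' : forall X, hom (T' (S' X)) (S' (T' X))) :
  has_components lam lam' ->
  splits (wdl_idem lam) r s <->
  (forall X, r' X ⊙ s' X = idm (U' X)) /\
  (forall X, s' X ⊙ r' X
     = S' ▹ mul T' X ⊙ lam' (T' X) ⊙ ret T' (S' (T' X))).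
Proof.
move=> hl; rewrite /splits /wdl_idem; split=> -[h1 h2]; split.
- to_components h1.
- to_components h2.
- of_components h1.
- of_components h2.
Qed.

Lemma unit_of_wdl_components :
  has_components (unit_of_wdl r)
    (fun X => r' X ⊙ (ret S' (T' X) ⊙ ret T' X)).
Proof.
rewrite /unit_of_wdl; match goal with |- has_components ?a _ =>
  let h := components_of a in exact h end.
Qed.

Lemma mul_of_wdl_components (lam : T · S ⇒ S · T)
    (lam' : forall X, hom (T' (S' X)) (S' (T' X))) :
  has_components lam lam' ->
  has_components (mul_of_wdl lam r s)
    (fun X => r' X ⊙ (mul S' (T' X) ⊙ S' ▹ S' ▹ mul T' X) ⊙ S' ▹ lam' (T' X)
       ⊙ (s' (S' (T' X)) ⊙ U' ▹ s' X)).
Proof.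
move=> hl; rewrite /mul_of_wdl; match goal with |- has_components ?a _ =>
  let h := components_of a in exact h end.
Qed.

End Translation.

(** * Both directions for 2-cells, with S and T fixed *)

Section Correspondence.

Context (K : twocat) (C : K) (S T : monad C).

Local Notation E := (hom_category C C).
Local Notation S' := (cat_monad_of S).
Local Notation T' := (cat_monad_of T).

(** The families for the unit and product of U are arbitrary: the canonical components serve in one
    direction, the formulas in λ, r and s in the other. *)
Lemma retraction_components (U : monad C) (r : S · T ⇒ U) (s : U ⇒ S · T)
    (etaU : forall X : E, hom X (post U X))
    (muU : forall X : E, hom (post U (post U X)) (post U X)) :
  has_components (eta U) etaU -> has_components (mu U) muU ->
  distributing_retraction r s <->
  @retraction_laws E S' T' (post U) etaU muU (retr_components r)
    (sec_components s) (inl_components r) (inr_components r).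
Proof.
move=> he hm.
have hr : has_components r (retr_components r) := componentsP _ _ _.
have hs : has_components s (sec_components s) := componentsP _ _ _.
have hetaS : has_components (eta S) (ret S') := unit_componentsP _.
have hetaT : has_components (eta T) (ret T') := unit_componentsP _.
have hmuS : has_components (mu S) (mul S') := mul_componentsP _.
have hmuT : has_components (mu T) (mul T') := mul_componentsP _.
have hinl := inl_componentsP r; have hinr := inr_componentsP r.
split=> [[h1 h2 h3 h4 h5 h6 h7]|[_ _ h1 h2 h3 h4 h5 h6 h7]].
- split=> //.
  + to_components h1.
  + to_components h2.
  + to_components h3.
  + to_components h4.
  + to_components h5.
  + to_components h6.
  + to_components h7.
- split.
  + of_components h1.
  + of_components h2.
  + of_components h3.
  + of_components h4.
  + of_components h5.
  + of_components h6.
  + of_components h7.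
Qed.

Lemma wdl_of_retraction_components (U : monad C) (r : S · T ⇒ U) (s : U ⇒ S · T)
    (muU : forall X : E, hom (post U (post U X)) (post U X)) :
  has_components (mu U) muU ->
  has_components (wdl_of_retraction r s)
    (fun X : E => (sec_components s X ⊙ muU X)
       ⊙ (inr_components r (post U X) ⊙ T' ▹ inl_components r X)).
Proof.
move=> hm.
have hs : has_components s (sec_components s) := componentsP _ _ _.
have hinl := inl_componentsP r; have hinr := inr_componentsP r.
rewrite /wdl_of_retraction; match goal with |- has_components ?a _ =>
  let h := components_of a in exact h end.
Qed.

Section RetractionToWdl.

Context (U : monad C) (r : S · T ⇒ U) (s : U ⇒ S · T).
Hypothesis rs : distributing_retraction r s.

Local Notation U' := (cat_monad_of U).

Let laws : @retraction_laws E S' T' U' (ret U') (mul U') (retr_components r)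
  (sec_components s) (inl_components r) (inr_components r).
Proof.
exact: (proj1 (retraction_components _ _ (unit_componentsP _)
  (mul_componentsP _)) rs).
Qed.

Let hlam := wdl_of_retraction_components r s (mul_componentsP (mu U)).

Lemma retraction_wdl : weak_distributive_law (wdl_of_retraction r s).
Proof.
apply/(wdl_components hlam).
exact: (@retraction_wdl_laws E S' T' U' _ _ (@retr_nat _ _ _ _ _ r)
  (@sec_nat _ _ _ _ _ s) _ _ _ laws (fun=> erefl)).
Qed.

Lemma retraction_splits : splits (wdl_idem (wdl_of_retraction r s)) r s.
Proof.
apply/(splits_components r s hlam); split.
  exact: rl_retract laws.
exact: (@retraction_idem E S' T' U' _ _ _ _ _ laws (fun=> erefl)).
Qed.

Lemma unit_of_retraction : unit_of_wdl r = eta U.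
Proof.
apply: eq2_eq; apply: eq2_of_components (unit_of_wdl_components r)
  (unit_componentsP _) _.
exact: rl_unit laws.
Qed.

Lemma mul_of_retraction : mul_of_wdl (wdl_of_retraction r s) r s = mu U.
Proof.
apply: eq2_eq; apply: eq2_of_components
  (mul_of_wdl_components r s hlam)
  (mul_componentsP _) _.
exact: (@retraction_mul E S' T' U' _ _ (@retr_nat _ _ _ _ _ r)
  (@sec_nat _ _ _ _ _ s) _ _ _ laws (fun=> erefl)).
Qed.

End RetractionToWdl.

Section WdlToRetraction.

Context (U : cell1 C C) (lam : T · S ⇒ S · T).
Context (r : S · T ⇒ U) (s : U ⇒ S · T).
Hypothesis hlam : weak_distributive_law lam.
Hypothesis hsplit : splits (wdl_idem lam) r s.

Definition lam_components (X : E) : hom (T' (S' X)) (S' (T' X)) :=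
  components lam (fun X => esym (comp1A T S X)) (fun X => esym (comp1A S T X)) X.

Let hl : has_components lam lam_components := componentsP _ _ _.

Lemma lam_nat (X Y : E) (h : hom X Y) :
  lam_components Y ⊙ T' ▹ S' ▹ h
  = S' ▹ T' ▹ h ⊙ lam_components X.
Proof.
exact (components_natural (action_comp1 (action_post T) (action_post S))
  (action_comp1 (action_post S) (action_post T)) hl h).
Qed.

Let laws := proj1 (wdl_components hl) hlam.
Let retract := proj1 (proj1 (splits_components r s hl) hsplit).
Let idem := proj2 (proj1 (splits_components r s hl) hsplit).

Lemma wdl_is_monad : is_monad (unit_of_wdl r) (mul_of_wdl lam r s).
Proof.
apply/(is_monad_components (unit_of_wdl_components r)
  (mul_of_wdl_components r s hl)).
by apply: (wdl_monad_laws (@retr_nat _ _ _ _ _ r) (@sec_nat _ _ _ _ _ s)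
  lam_nat laws retract idem).
Qed.

Lemma wdl_retraction : @distributing_retraction K C S T (Monad wdl_is_monad) r s.
Proof.
apply/(@retraction_components (Monad wdl_is_monad) r s _ _
  (unit_of_wdl_components r) (mul_of_wdl_components r s hl)).
by apply: (wdl_retraction_laws (@retr_nat _ _ _ _ _ r) (@sec_nat _ _ _ _ _ s)
  lam_nat laws retract idem).
Qed.

Lemma wdl_of_wdl_retraction :
  @wdl_of_retraction K C S T (Monad wdl_is_monad) r s = lam.
Proof.
apply: eq2_eq; apply: eq2_of_components
  (@wdl_of_retraction_components (Monad wdl_is_monad) r s _
     (mul_of_wdl_components r s hl)) hl _.
by apply: (@wdl_recover E S' T' (post U) _ _ _ (@retr_nat _ _ _ _ _ r)
  lam_nat laws retract idem).
Qed.

End WdlToRetraction.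

End Correspondence.

(** * The correspondence *)

Section Tuples.

Context (K : twocat) (C : K).

(** The 1-cell of U is shared, so r and s need no transport; once η and μ agree, only proofs can
    differ. *)
Lemma retraction_tuple_eq (S T : monad C) (U : cell1 C C)
    (eta eta' : one1 C ⇒ U) (mu mu' : U · U ⇒ U)
    (hU : is_monad eta mu) (hU' : is_monad eta' mu')
    (r : S · T ⇒ U) (s : U ⇒ S · T)
    (rs : @distributing_retraction K C S T (Monad hU) r s)
    (rs' : @distributing_retraction K C S T (Monad hU') r s) :
  eta = eta' -> mu = mu' -> RetractionTuple rs = RetractionTuple rs'.
Proof.
move=> eq_eta eq_mu; subst eta' mu'.
rewrite (proof_irrelevance _ hU' hU) in rs' *.
by rewrite (proof_irrelevance _ rs' rs).
Qed.

Lemma wdl_tuple_eq (S T : monad C) (U : cell1 C C) (lam lam' : T · S ⇒ S · T)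
    (r : S · T ⇒ U) (s : U ⇒ S · T)
    (hlam : weak_distributive_law lam) (hlam' : weak_distributive_law lam')
    (hsplit : splits (wdl_idem lam) r s) (hsplit' : splits (wdl_idem lam') r s) :
  lam = lam' -> WdlTuple hlam hsplit = WdlTuple hlam' hsplit'.
Proof.
move=> eq_lam; subst lam'.
by rewrite (proof_irrelevance _ hlam' hlam) (proof_irrelevance _ hsplit' hsplit).
Qed.

Definition tuple_to_wdl (t : retraction_tuple C) : wdl_tuple C :=
  WdlTuple (retraction_wdl (rt_retraction t))
    (retraction_splits (rt_retraction t)).

Definition tuple_to_retraction (t : wdl_tuple C) : retraction_tuple C :=
  RetractionTuple (wdl_retraction (wt_wdl t) (wt_splits t)).

End Tuples.

Theorem mainTheorem1 (K : twocat) (C : K) :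
  exists (f : retraction_tuple C -> wdl_tuple C)
         (g : wdl_tuple C -> retraction_tuple C),
    cancel f g /\ cancel g f /\
    (forall (S T U : monad C) (r : S · T ⇒ U) (s : U ⇒ S · T)
            (hrs : distributing_retraction r s),
       exists (hlam : weak_distributive_law (wdl_of_retraction r s))
              (hsplit : splits (wdl_idem (wdl_of_retraction r s)) r s),
         f (RetractionTuple hrs) = WdlTuple hlam hsplit) /\
    (forall (S T : monad C) (U : cell1 C C) (lam : T · S ⇒ S · T)
            (r : S · T ⇒ U) (s : U ⇒ S · T)
            (hlam : weak_distributive_law lam)
            (hsplit : splits (wdl_idem lam) r s),
       exists (hU : is_monad (unit_of_wdl r) (mul_of_wdl lam r s))
              (hrs : @distributing_retraction K C S T (Monad hU) r s),
         g (WdlTuple hlam hsplit) = RetractionTuple hrs).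
Proof.
exists (@tuple_to_wdl K C), (@tuple_to_retraction K C); split; [|split; [|split]].
(* Splitting the monad U exposes its 1-cell, which the round trip preserves; only its unit and
   product remain to be compared. *)
- move=> [S T [U etaU muU hU] r s rs].
  apply: retraction_tuple_eq; first exact: unit_of_retraction rs.
  exact: mul_of_retraction rs.
- by move=> [S T U lam r s hlam hsplit]; apply/wdl_tuple_eq/wdl_of_wdl_retraction.
(* The prescribed formulas hold by definition of the two maps, and unification supplies the
   proofs. *)
- by move=> S T U r s rs; do 2 eexists.
- by move=> S T U lam r s hlam hsplit; do 2 eexists.
Qed.
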